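(* Let $\mathcal{G}=(G^0,\mathcal{G}^1,r,s)$ be an ultragraph such that every vertex is regular, that is, $0<|s^{-1}(v)|<\infty$ for all $v\in G^0$, and let $\mathsf{X}_{\mathcal{G}}$ be its one-sided edge subshift. Then $C^*(\mathcal{G})\cong\mathcal{O}_{\mathsf{X}_{\mathcal{G}}}$.
   Context: An ultragraph $\mathcal{G}=(G^0,\mathcal{G}^1,r,s)$ consists of a set of vertices $G^0$, a set of edges $\mathcal{G}^1$, a source map $s:\mathcal{G}^1\to G^0$ and a range map $r:\mathcal{G}^1\to P(G^0)\setminus\{\emptyset\}$, where $P(G^0)$ is the power set. Let $\mathcal{G}^0$ be the smallest family of subsets of $G^0$ containing $\emptyset$, $\{v\}$ for all $v\in G^0$ and $r(e)$ for all $e\in\mathcal{G}^1$, and closed under finite unions and finite (non-empty) intersections. The ultragraph C*-algebra $C^*(\mathcal{G})$ is the universal C*-algebra generated by projections $\{q_A:A\in\mathcal{G}^0\}$ and partial isometries $\{t_e:e\in\mathcal{G}^1\}$ with mutually orthogonal ranges such that $q_\emptyset=0$, $q_Aq_B=q_{A\cap B}$, $q_{A\cup B}=q_A+q_B-q_{A\cap B}$; $t_e^*t_e=q_{r(e)}$; $t_et_e^*\le q_{\{s(e)\}}$; and $q_{\{v\}}=\sum_{s(e)=v}t_et_e^*$ whenever $0<|s^{-1}(v)|<\infty$. The one-sided edge subshift $\mathsf{X}_{\mathcal{G}}$ of $\mathcal{G}$ is the set of all infinite paths, i.e. the set of all sequences over the alphabet $\mathscr{A}=\mathcal{G}^1$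 containing none of the words $ef$ with $s(f)\notin r(e)$. For a subshift $\mathsf{X}$ over an alphabet $\mathscr{A}$, $\mathcal{L}_{\mathsf{X}}$ is the set of all finite words occurring in elements of $\mathsf{X}$, including the empty word $\omega$. For $\alpha,\beta\in\mathcal{L}_{\mathsf{X}}$ put $C(\alpha,\beta)=\{\beta x\in\mathsf{X}:\alpha x\in\mathsf{X}\}$. $\mathcal{B}$ is the (generalised, i.e. not necessarily containing $\mathsf{X}$) Boolean algebra of subsets of $\mathsf{X}$ generated (under finite unions, finite intersections and relative complements) by all $C(\alpha,\beta)$ with $\alpha,\beta\in\mathcal{L}_{\mathsf{X}}$ not both equal to $\omega$. $\mathcal{O}_{\mathsf{X}}$ is the universal C*-algebra generated by projections $\{p_A:A\in\mathcal{B}\}$ and partial isometries $\{s_a:a\in\mathscr{A}\}$ subject to: (i) $p_{A\cap B}=p_Ap_B$, $p_{A\cup B}=p_A+p_B-p_{A\cap B}$, $p_\emptyset=0$ for all $A,B\in\mathcal{B}$; (ii) $s_\beta s_\alpha^*s_\alpha s_\beta^*=p_{C(\alpha,\beta)}$ for all $\alpha,\beta\in\mathcal{L}_{\mathsf{X}}\setminus\{\omega\}$, where $s_\alpha=s_{\alpha_1}\cdots s_{\alpha_n}$ for $\alpha=\alpha_1\cdots\alpha_n$; (iii) $s_\alpha^*s_\alpha=p_{C(\alpha,\omega)}$ for all $\alpha\in\mathcal{L}_{\mathsf{X}}\setminus\{\omega\}$; (iv) $s_\beta s_\beta^*=p_{C(\omega,\beta)}$ for all $\beta\in\mathcal{L}_{\mathsf{X}}\setminus\{\omega\}$.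 *)

(* Defs.v *)
From HB Require Import structures.
From mathcomp Require Import all_boot all_order all_algebra.
From mathcomp Require Import complex.
From mathcomp Require Import all_classical all_reals all_analysis.

Set Implicit Arguments.
Unset Strict Implicit.
Unset Printing Implicit Defensive.

Import Order.TTheory GRing.Theory Num.Theory.
Import numFieldNormedType.Exports.

Local Open Scope classical_set_scope.
Local Open Scope ring_scope.

(* Not assumed unital: neither C*(G) nor O_X need have a unit, hence the product
   is declared here instead of being inherited from the ring hierarchy. *)
HB.mixin Record CompleteNormedModule_isCStarAlgebra (R : realType) A
    of CompleteNormedModule R[i] A := {
  cmul : A -> A -> A;
  cstar : A -> A;
  cmulA : associative cmul;
  cmulDl : left_distributive cmul +%R;
  cmulDr : right_distributive cmul +%R;
  cscalerAl : forall (k : R[i]) (a b : A), k *: cmul a b = cmul (k *: a) b;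
  cscalerAr : forall (k : R[i]) (a b : A), k *: cmul a b = cmul a (k *: b);
  cstarK : involutive cstar;
  cstarD : {morph cstar : a b / a + b};
  cstarZ : forall (k : R[i]) (a : A), cstar (k *: a) = Num.conj k *: cstar a;
  cstarM : forall a b : A, cstar (cmul a b) = cmul (cstar b) (cstar a);
  cnorm_mul : forall a b : A, `|cmul a b| <= `|a| * `|b|;
  cnorm_starM : forall a : A, `|cmul (cstar a) a| = `|a| ^+ 2
}.

#[short(type="cstarAlgType")]
HB.structure Definition CStarAlgebra (R : realType) :=
  {A of CompleteNormedModule_isCStarAlgebra R A & CompleteNormedModule R[i] A}.

Declare Scope cstar_scope.
Notation "a ** b" := (cmul a b) (at level 40, left associativity) : cstar_scope.
Notation "a ^*" := (cstar a) : cstar_scope.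
Local Open Scope cstar_scope.

Section CStarNotions.
Context {R : realType}.

Definition projection {A : cstarAlgType R} (p : A) : Prop :=
  p ^* = p /\ p ** p = p.

Definition partial_isometry {A : cstarAlgType R} (t : A) : Prop :=
  t ** t ^* ** t = t.

Definition cstar_le {A : cstarAlgType R} (a b : A) : Prop :=
  exists c : A, b - a = c ^* ** c.

(* Such maps are automatically norm-decreasing, and isometric when injective. *)
Definition star_hom {A B : cstarAlgType R} (phi : A -> B) : Prop :=
  [/\ linear phi,
      {morph phi : a b / a ** b} &
      {morph phi : a / a ^*}].

Definition star_isomorphic (A B : cstarAlgType R) : Prop :=
  exists phi : A -> B, star_hom phi /\ bijective phi.

End CStarNotions.

(* Classically every type carries a [choiceType] structure; it is asked of the
   edges for the sake of the finite sums [\sum_(e \in _) _]. *)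
Record ultragraph := Ultragraph {
  vertex : Type;
  edge : choiceType;
  usource : edge -> vertex;
  urange : edge -> set vertex;
  urange_neq0 : forall e, urange e !=set0
}.

Section UltragraphAlgebra.
Variables (R : realType) (G : ultragraph).

Definition edges_from (v : vertex G) : set (edge G) :=
  [set e | usource e = v].

Definition regular_vertex (v : vertex G) : Prop :=
  edges_from v !=set0 /\ finite_set (edges_from v).

Definition gen_vertices : set (set (vertex G)) :=
  smallest [set F | setU_closed F /\ setI_closed F]
    ([set set0] `|` range (fun v : vertex G => [set v]) `|` range (@urange G)).

(* [q] is a family indexed by [gen_vertices]: its values elsewhere play no
   role here, nor in [is_ultragraph_algebra]. *)
Record ultragraph_family (A : cstarAlgType R)
    (q : set (vertex G) -> A) (t : edge G -> A) : Prop := {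
  uf_proj : forall U, gen_vertices U -> projection (q U);
  uf_pisom : forall e, partial_isometry (t e);
  uf_orth : forall e f, e <> f -> (t e ** (t e) ^*) ** (t f ** (t f) ^*) = 0;
  uf_set0 : q set0 = 0;
  uf_setI : forall U W, gen_vertices U -> gen_vertices W ->
    q U ** q W = q (U `&` W);
  uf_setU : forall U W, gen_vertices U -> gen_vertices W ->
    q (U `|` W) = q U + q W - q (U `&` W);
  uf_range : forall e, (t e) ^* ** t e = q (urange e);
  uf_source : forall e, cstar_le (t e ** (t e) ^*) (q [set usource e]);
  uf_regular : forall v, regular_vertex v ->
    q [set v] = \sum_(e \in edges_from v) (t e ** (t e) ^*)
}.

(* The universal property that defines C*(G), together with its generators,
   up to a unique isomorphism. *)
Definition is_ultragraph_algebra (A : cstarAlgType R)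
    (q : set (vertex G) -> A) (t : edge G -> A) : Prop :=
  ultragraph_family q t /\
  forall (B : cstarAlgType R) (q' : set (vertex G) -> B) (t' : edge G -> B),
    ultragraph_family q' t' ->
    exists! phi : A -> B,
      [/\ star_hom phi,
          forall U, gen_vertices U -> phi (q U) = q' U &
          forall e, phi (t e) = t' e].

End UltragraphAlgebra.

Section Subshift.
Variable (S : Type).

Definition occurs (w : seq S) (x : nat -> S) : Prop :=
  exists n : nat, mkseq (fun i => x (n + i)%N) (size w) = w.

Definition subshift_avoiding (F : set (seq S)) : set (nat -> S) :=
  [set x | forall w, F w -> ~ occurs w x].

(* The first alternative only matters when [X] is empty. *)
Definition language (X : set (nat -> S)) : set (seq S) :=
  [set w | w = [::] \/ exists2 x, X x & occurs w x].

(* The sequence [w x]; the default value of [nth] is reached beyond [w]. *)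
Definition prepend (w : seq S) (x : nat -> S) : nat -> S :=
  fun n => nth (x (n - size w)%N) w n.

Definition Cset (X : set (nat -> S)) (a b : seq S) : set (nat -> S) :=
  [set prepend b x | x in [set x | X (prepend b x) /\ X (prepend a x)]].

Definition shift_boolalg (X : set (nat -> S)) : set (set (nat -> S)) :=
  <<r [set U | exists a b, [/\ language X a, language X b,
                               ~ (a = [::] /\ b = [::]) & U = Cset X a b]] >>.

Variable (R : realType).

(* Only meaningful on nonempty words, as there is no unit. *)
Definition word_elt {A : cstarAlgType R} (s : S -> A) (w : seq S) : A :=
  if w is a :: w' then foldl (fun c b => c ** s b) (s a) w' else 0.

(* As above, [p] only matters on [shift_boolalg X]. *)
Record subshift_family (X : set (nat -> S)) (A : cstarAlgType R)
    (p : set (nat -> S) -> A) (s : S -> A) : Prop := {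
  sf_proj : forall U, shift_boolalg X U -> projection (p U);
  sf_pisom : forall a, partial_isometry (s a);
  sf_setI : forall U W, shift_boolalg X U -> shift_boolalg X W ->
    p (U `&` W) = p U ** p W;
  sf_setU : forall U W, shift_boolalg X U -> shift_boolalg X W ->
    p (U `|` W) = p U + p W - p (U `&` W);
  sf_set0 : p set0 = 0;
  sf_C : forall a b, language X a -> language X b -> a <> [::] -> b <> [::] ->
    word_elt s b ** (word_elt s a) ^* ** word_elt s a ** (word_elt s b) ^*
      = p (Cset X a b);
  sf_Cl : forall a, language X a -> a <> [::] ->
    (word_elt s a) ^* ** word_elt s a = p (Cset X a [::]);
  sf_Cr : forall b, language X b -> b <> [::] ->
    word_elt s b ** (word_elt s b) ^* = p (Cset X [::] b)
}.

(* The universal property that defines O_X. *)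
Definition is_subshift_algebra (X : set (nat -> S)) (A : cstarAlgType R)
    (p : set (nat -> S) -> A) (s : S -> A) : Prop :=
  subshift_family X p s /\
  forall (B : cstarAlgType R) (p' : set (nat -> S) -> B) (s' : S -> B),
    subshift_family X p' s' ->
    exists! phi : A -> B,
      [/\ star_hom phi,
          forall U, shift_boolalg X U -> phi (p U) = p' U &
          forall a, phi (s a) = s' a].

End Subshift.

Definition edge_subshift (G : ultragraph) : set (nat -> edge G) :=
  subshift_avoiding
    [set w | exists e f, w = [:: e; f] /\ ~ urange e (usource f)].

Arguments edge_subshift G : clear implicits.

(* Main.v *)
Require Import Defs.
From mathcomp Require Import all_boot all_order all_algebra.
From mathcomp Require Import complex finmap.
From mathcomp Require Import all_classical all_reals all_analysis.

Set Implicit Arguments.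
Unset Strict Implicit.
Unset Printing Implicit Defensive.

Import GRing.Theory.

Local Open Scope classical_set_scope.
Local Open Scope ring_scope.
Local Open Scope cstar_scope.
Local Notation "a ^*" := (cstar a) : ring_scope.

(** Both algebras are generated by their edge elements alone. In [C^*(G)]
    regularity gives [q_v] as the sum of the [t_e t_e^*] with [s(e) = v], and
    [q_r(e) = t_e^* t_e]; unions and intersections yield the other [q_U]
    ([edge_fixing_hom]). In [O_X] every [p] of a generating set [C(a,b)] is a
    product of letters and their adjoints ([letter_fixing_hom]). Hence, if each
    algebra carries a family of the other kind with the same edge elements, the
    two universal properties provide homomorphisms that exchange [t_e] and
    [s_e], and these are mutually inverse.

    From [O_X] to an ultragraph family, put [q_U := p] of the set of infinite
    paths that start in [U]. Each edge begins an infinite path, so the letters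
    are in the language; paths starting in [r(e)] form [C(e,omega)], and paths
    starting at [v] form the finite disjoint union of the [C(omega,e)] with
    [s(e) = v] ([subshift_to_ultragraph_family]).

    From [C^*(G)] to a subshift family, a projection has to be attached to every
    set of the Boolean algebra generated by the [C(a,b)], compatibly with the
    prescribed values on the generators. The difficulty is that this is well
    defined. The predicate [represents n f a] says that the element [a] acts as
    the function [f] on paths: off a negligible (for instance finite) set of
    initial vertices [a] is a linear combination of projections [q_U] and [f] is
    the same combination of indicator functions of the initial vertex; moreover
    each compression [t_e^* a t_e] represents, at depth [n - 1], the function
    [x |-> f (e x)].
    Going down one edge at a time is what makes infinite ranges harmless: [q_v]
    is a finite sum over edges, but in general not a finite sum over paths of
    length two. Represented pairs form an algebra ([represents_lin],
    [represents_mul]) that contains the indicator functions of the [C(a,b)]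
    ([represents_Cset], [represents_source], [represents_range]), and [f]
    determines [a] ([represents_eq0]). So a set [W] gets the unique self-adjoint
    element representing its indicator function; the relations of the family
    hold because both sides represent the same function.

    Uniqueness reduces to the vertices: if a combination of indicator functions
    of sets [U] vanishes, so does the same combination of the [q_U]
    ([vertex_span_vanish]). That is the extension theorem for valuations on a
    lattice of sets, with values in an algebra. *)

(** * Arithmetic in a C*-algebra without unit *)

Section CStarArithmetic.
Context {R : realType} {A : cstarAlgType R}.
Implicit Types (a b c : A) (k : R[i]).

Lemma cmul0l a : 0 ** a = 0.
Proof. by apply: (addrI (0 ** a)); rewrite -cmulDl !addr0. Qed.

Lemma cmul0r a : a ** 0 = 0.
Proof. by apply: (addrI (a ** 0)); rewrite -cmulDr !addr0. Qed.

Lemma cmulNl a b : (- a) ** b = - (a ** b).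
Proof. by apply/eqP; rewrite -addr_eq0 -cmulDl addNr cmul0l. Qed.

Lemma cmulNr a b : a ** (- b) = - (a ** b).
Proof. by apply/eqP; rewrite -addr_eq0 -cmulDr addNr cmul0r. Qed.

Lemma cmulBl a b c : (a - b) ** c = a ** c - b ** c.
Proof. by rewrite cmulDl cmulNl. Qed.

Lemma cmulBr a b c : a ** (b - c) = a ** b - a ** c.
Proof. by rewrite cmulDr cmulNr. Qed.

Lemma cmul_sumr (I : Type) (l : seq I) (F : I -> A) a :
  a ** (\sum_(i <- l) F i) = \sum_(i <- l) a ** F i.
Proof. exact: (big_morph (cmul a) (cmulDr a) (cmul0r a)). Qed.

Lemma cmul_suml (I : Type) (l : seq I) (F : I -> A) a :
  (\sum_(i <- l) F i) ** a = \sum_(i <- l) F i ** a.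
Proof. exact: (big_morph (cmul^~ a) (fun b c => cmulDl b c a) (cmul0l a)). Qed.

Lemma cstar0 : (0 : A)^* = 0.
Proof. by apply: (addrI ((0 : A)^*)); rewrite -cstarD !addr0. Qed.

Lemma cstarB a b : (a - b)^* = a^* - b^*.
Proof.
suff N : (- b)^* = - b^* by rewrite cstarD N.
by apply/eqP; rewrite -addr_eq0 -cstarD addNr cstar0.
Qed.

Lemma partial_isometry_star (x : A) :
  partial_isometry x -> x^* ** x ** x^* = x^*.
Proof. by move=> H; rewrite -{4}H !cstarM cstarK cmulA. Qed.

(** For partial isometries [x] and [y], orthogonality of the range projections
    passes to [x] and [y] themselves, since [x^* = x^* x x^*]. *)
Lemma partial_isometry_orth (x y : A) :
  partial_isometry x -> partial_isometry y ->
  (x ** x^*) ** (y ** y^*) = 0 -> x^* ** y = 0.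
Proof.
move=> hx hy h.
rewrite -hy -(partial_isometry_star hx) !cmulA.
have -> : x^* ** x ** x^* ** y ** y^* ** y
  = x^* ** ((x ** x^*) ** (y ** y^*)) ** y by rewrite !cmulA.
by rewrite h cmul0r cmul0l.
Qed.

End CStarArithmetic.

(** * Homomorphisms *)

Section StarHom.
Context {R : realType}.

Lemma star_hom_comp (A B C : cstarAlgType R) (phi : A -> B) (psi : B -> C) :
  star_hom phi -> star_hom psi -> star_hom (psi \o phi).
Proof.
case=> l1 m1 s1 [l2 m2 s2]; split=> [k a b|a b|a] /=.
- by rewrite l1 l2.
- by rewrite m1 m2.
- by rewrite s1 s2.
Qed.

Lemma star_homD (A B : cstarAlgType R) (phi : A -> B) :
  star_hom phi -> {morph phi : a b / a + b}.
Proof. by case=> l _ _ a b; have := l 1 a b; rewrite !scale1r. Qed.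

Lemma star_hom0 (A B : cstarAlgType R) (phi : A -> B) :
  star_hom phi -> phi 0 = 0.
Proof. by move/star_homD=> D; apply: (addrI (phi 0)); rewrite -D !addr0. Qed.

Lemma star_homB (A B : cstarAlgType R) (phi : A -> B) :
  star_hom phi -> {morph phi : a b / a - b}.
Proof.
move=> h a b; apply/eqP; rewrite eq_sym subr_eq -(star_homD h).
by rewrite subrK.
Qed.

End StarHom.

(** * The lattice of vertex sets *)

Section GenVertices.
Variable G : ultragraph.
Implicit Types (U W : set (vertex G)) (v : vertex G) (e : edge G).

Lemma gen_verticesU : setU_closed (@gen_vertices G).
Proof. by move=> U W hU hW F hF; apply: hF.1.1; [exact: hU|exact: hW]. Qed.

Lemma gen_verticesI : setI_closed (@gen_vertices G).
Proof. by move=> U W hU hW F hF; apply: hF.1.2; [exact: hU|exact: hW]. Qed.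

Lemma gen_vertices0 : gen_vertices (set0 : set (vertex G)).
Proof. by move=> F [_ hF]; apply: hF; left; left. Qed.

Lemma gen_vertices1 v : gen_vertices [set v].
Proof. by move=> F [_ hF]; apply: hF; left; right; exists v. Qed.

Lemma gen_vertices_range e : gen_vertices (urange e).
Proof. by move=> F [_ hF]; apply: hF; right; exists e. Qed.

(** Sets are proved to be in the family along with the property, so that the
    union and intersection cases may use the relations that hold only there. *)
Lemma gen_vertices_ind (P : set (vertex G) -> Prop) :
  P set0 -> (forall v, P [set v]) -> (forall e, P (urange e)) ->
  (forall U W, gen_vertices U -> gen_vertices W -> P U -> P W -> P (U `|` W)) ->
  (forall U W, gen_vertices U -> gen_vertices W -> P U -> P W -> P (U `&` W)) ->
  forall U, gen_vertices U -> P U.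
Proof.
move=> h0 h1 hr hU hI U gU.
suff [] : (@gen_vertices G `&` P) U by [].
apply: gU; split; last first.
  move=> W [[->|[v _ <-]]|[e _ <-]]; split=> //.
  - exact: gen_vertices0.
  - exact: gen_vertices1.
  - exact: gen_vertices_range.
split=> V W [gV pV] [gW pW]; split.
- exact: gen_verticesU.
- exact: hU.
- exact: gen_verticesI.
- exact: hI.
Qed.

End GenVertices.

(** * Infinite paths *)

Section EdgeSubshift.
Variable G : ultragraph.
Hypothesis Greg : forall v : vertex G, regular_vertex v.
Local Notation X := (edge_subshift G).
Implicit Types (e : edge G) (x : nat -> edge G).

Lemma edge_subshiftP x :
  X x <-> forall n, urange (x n) (usource (x n.+1)).
Proof.
split=> [hx n|hx w [e [f [-> nef]]] [n [h1 h2]]].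
  apply: contrapT => nr; apply: (hx [:: x n; x n.+1]).
    by exists (x n), (x n.+1).
  by exists n; rewrite /mkseq /= addn0 addn1.
by apply: nef; rewrite -h1 -h2 addn0 addn1.
Qed.

Lemma prepend1S e x n : prepend [:: e] x n.+1 = x n.
Proof. by rewrite /prepend /= nth_nil subn1. Qed.

Lemma prepend0 x : prepend [::] x = x.
Proof. by apply/funext => n; rewrite /prepend /= nth_nil subn0. Qed.

Lemma prepend_cons e w x : prepend (e :: w) x = prepend [:: e] (prepend w x).
Proof.
apply/funext => -[//|n]; rewrite prepend1S /prepend /= subSS //.
Qed.

Lemma prepend_rcons e w x : prepend (rcons w e) x = prepend w (prepend [:: e] x).
Proof.
elim: w => [|f w IH] /=; first by rewrite prepend0.
by rewrite prepend_cons IH -prepend_cons.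
Qed.

Lemma edge_subshift_prepend1 e x :
  X (prepend [:: e] x) <-> urange e (usource (x 0)) /\ X x.
Proof.
split=> [/edge_subshiftP h|[he /edge_subshiftP hx]].
  split; first by have := h 0; rewrite prepend1S.
  by apply/edge_subshiftP => n; have := h n.+1; rewrite !prepend1S.
by apply/edge_subshiftP => -[|n]; rewrite !prepend1S.
Qed.

Lemma edge_subshift_suffix w x : X (prepend w x) -> X x.
Proof.
elim: w => [|e w IH]; first by rewrite prepend0.
by rewrite prepend_cons => /edge_subshift_prepend1 [_ /IH].
Qed.

Lemma edge_subshift_tail x : X x -> X (fun n => x n.+1).
Proof. by move=> /edge_subshiftP h; apply/edge_subshiftP => n. Qed.

Lemma prepend_tail x : prepend [:: x 0] (fun n => x n.+1) = x.
Proof. by apply/funext => -[//|n]; rewrite prepend1S. Qed.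

(** Ranges are nonempty and every vertex emits an edge: iterate a choice of
    successor. *)
Lemma exists_path_edge e : exists2 x, X x & x 0 = e.
Proof.
have /choice [next hnext] : forall e, exists f, urange e (usource f).
  move=> f; have [v hv] := urange_neq0 f.
  by have [[g hg] _] := Greg v; exists g; rewrite hg.
exists (fun n => iter n next e) => //; apply/edge_subshiftP => n /=.
exact: hnext.
Qed.

Lemma exists_path_vertex v : exists2 x, X x & usource (x 0) = v.
Proof.
have [[e he] _] := Greg v; have [x Xx x0] := exists_path_edge e.
by exists x; rewrite ?x0.
Qed.

Lemma language_edge e : language X [:: e].
Proof.
have [x Xx x0] := exists_path_edge e.
by right; exists x => //; exists 0; rewrite /mkseq /= addn0 x0.
Qed.

End EdgeSubshift.

(** * From an ultragraph family to a subshift family *)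

Section UltragraphFamily.
Variables (R : realType) (G : ultragraph).
Hypothesis Greg : forall v : vertex G, regular_vertex v.
Variables (A : cstarAlgType R) (q : set (vertex G) -> A) (t : edge G -> A).
Hypothesis qt : ultragraph_family q t.
Local Notation X := (edge_subshift G).
Implicit Types (a b y : A) (k : R[i]) (e : edge G) (v : vertex G)
  (U P Q F : set (vertex G)) (V W : set (nat -> edge G)) (x : nat -> edge G)
  (f : (nat -> edge G) -> R[i]) (g : vertex G -> R[i]).

Lemma edge_orth (e f : edge G) : e <> f -> (t e)^* ** t f = 0.
Proof.
move=> ef; apply: partial_isometry_orth; first exact: uf_pisom qt e.
  exact: uf_pisom qt f.
exact: uf_orth qt _ _ ef.
Qed.

Lemma edge_range e : t e ** q (urange e) = t e.
Proof. by rewrite -(uf_range qt) cmulA (uf_pisom qt e). Qed.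

Lemma vertex_sum v :
  q [set v] = \sum_(e <- fset_set (edges_from v)) (t e ** (t e)^*).
Proof.
rewrite (uf_regular qt (Greg v)) fsbig_finite //; exact: (Greg v).2.
Qed.

Lemma mem_edges_from v e : (e \in fset_set (edges_from v)) = `[< usource e = v >].
Proof. by rewrite in_fset_set //; exact: (Greg v).2. Qed.

(** By regularity [q_v] is a finite sum of mutually orthogonal range projections,
    and [t_e t_e^*] is one of the summands. *)
Lemma vertex_edge e : q [set usource e] ** t e = t e.
Proof.
rewrite vertex_sum cmul_suml (bigD1_seq e) ?fset_uniq //=; last first.
  by rewrite mem_edges_from; apply/asboolP.
rewrite (uf_pisom qt e) big1 ?addr0 // => f fe.
by rewrite -cmulA edge_orth ?cmul0r //; exact/eqP.
Qed.

Lemma q_edge U e : gen_vertices U -> q U ** t e = \1_U (usource e) *: t e.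
Proof.
move=> gU; have g1 := @gen_vertices1 G (usource e).
rewrite -{1}(vertex_edge e) cmulA (uf_setI qt) // indicE.
have [/set_mem Ue|/negP nUe] := boolP (_ \in U).
  rewrite scale1r (_ : U `&` _ = [set usource e]) ?vertex_edge //.
  by apply/seteqP; split=> [v []|v ->].
rewrite scale0r (_ : U `&` _ = set0) ?(uf_set0 qt) ?cmul0l //.
by apply/seteqP; split=> [v [Uv ve]|//]; apply: nUe; rewrite -ve; exact/mem_set.
Qed.

(** The linear span of the pairs of an indicator function and its projection
    [q_U]. It is a relation between functions and elements; that it is the graph
    of a map is the content of [vertex_span_vanish]. *)
Inductive vertex_span : (vertex G -> R[i]) -> A -> Prop :=
| vertex_span0 : vertex_span (fun=> 0) 0
| vertex_spanD k U g b : gen_vertices U -> vertex_span g b ->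
    vertex_span (fun v => k * \1_U v + g v) (k *: q U + b).

(** The set [P `\` Q] may lie outside the lattice; [q P - q (P `&` Q)] is the
    projection that it ought to have. The next three lemmas cut it along [U] and
    say that [q U] is the identity on one piece and zero on the other. *)
Lemma relative_split U P Q :
    gen_vertices U -> gen_vertices P -> gen_vertices Q ->
  q P - q (P `&` Q) = q (P `&` U) - q (P `&` U `&` Q)
                      + (q P - q (P `&` (Q `|` U))).
Proof.
move=> gU gP gQ; have gI := @gen_verticesI G.
rewrite setIUr (uf_setU qt); [|exact: gI|exact: gI].
rewrite (_ : P `&` Q `&` (P `&` U) = P `&` U `&` Q); last first.
  by rewrite setIACA setIid setIA setIAC.
rewrite opprB addrCA; congr (_ + _); rewrite addrA subrK.
by rewrite [X in _ - X]addrC opprD addrA subrr sub0r.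
Qed.

Lemma relative_in U P Q :
    gen_vertices U -> gen_vertices P -> gen_vertices Q ->
  q U ** (q (P `&` U) - q (P `&` U `&` Q)) = q (P `&` U) - q (P `&` U `&` Q).
Proof.
move=> gU gP gQ; have gI := @gen_verticesI G.
rewrite cmulBr !(uf_setI qt) //; try by do ?exact: gI.
  rewrite (_ : U `&` (P `&` U) = P `&` U); last by rewrite setICA setIid.
  by rewrite setIA (_ : U `&` (P `&` U) = P `&` U) // setICA setIid.
by apply: (gI) => //; apply: gI.
Qed.

Lemma relative_out U P Q :
    gen_vertices U -> gen_vertices P -> gen_vertices Q ->
  q U ** (q P - q (P `&` (Q `|` U))) = 0.
Proof.
move=> gU gP gQ; have gI := @gen_verticesI G; have gUn := @gen_verticesU G.
rewrite cmulBr !(uf_setI qt) //; last by apply: (gI) => //; apply: gUn.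
rewrite (_ : U `&` (P `&` (Q `|` U)) = U `&` P) ?subrr //.
by rewrite setICA setKU setIC.
Qed.

(** Linear relations between indicator functions hold between the projections.
    The statement is relative to a difference [P `\` Q] and a constant [k] in
    order to go through by induction on the combination: its first set [U] cuts
    [P `\` Q] into a piece where [q U] acts as a scalar, absorbed in [k], and a
    piece where it acts as zero. With nothing left in the combination, either
    [k = 0] or [P] is contained in [Q]. *)
Lemma vertex_span_vanish g b : vertex_span g b ->
  forall k P Q, gen_vertices P -> gen_vertices Q ->
    (forall v, P v -> ~ Q v -> k + g v = 0) ->
  k *: (q P - q (P `&` Q)) + b ** (q P - q (P `&` Q)) = 0.
Proof.
elim=> [|k' U g' b' gU _ IH] k P Q gP gQ h.
  rewrite cmul0l addr0.
  have [[v [Pv nQv]]|nPQ] := pselect (exists v, P v /\ ~ Q v).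
    by have := h v Pv nQv; rewrite addr0 => ->; rewrite scale0r.
  rewrite (_ : P `&` Q = P) ?subrr ?scaler0 //; apply/setIidl => v Pv.
  by apply: contrapT => nQv; apply: nPQ; exists v.
have gI := @gen_verticesI G; have gUn := @gen_verticesU G.
have IH1 : (k + k') *: (q (P `&` U) - q (P `&` U `&` Q))
           + b' ** (q (P `&` U) - q (P `&` U `&` Q)) = 0.
  apply: IH => // [|v [Pv Uv] nQv]; first exact: gI.
  by rewrite -(h v Pv nQv) indicE mem_set // mulr1 addrA.
have IH2 : k *: (q P - q (P `&` (Q `|` U)))
           + b' ** (q P - q (P `&` (Q `|` U))) = 0.
  apply: IH => // [|v Pv nv]; first exact: gUn.
  have [nQv nUv] : ~ Q v /\ ~ U v by apply/not_orP.
  by rewrite -(h v Pv nQv) indicE memNset // mulr0 add0r.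
rewrite (relative_split gU gP gQ).
move: (relative_in gU gP gQ) (relative_out gU gP gQ) IH1 IH2.
set E1 := q (P `&` U) - _; set E2 := q P - _ => in1 out2 IH1 IH2.
rewrite cmulDl -cscalerAl [q U ** _]cmulDr in1 out2 addr0 cmulDr scalerDr.
by rewrite [k' *: _ + _]addrA addrACA IH2 addr0 addrA -scalerDl.
Qed.

Lemma vertex_span_ext g b g' b' :
  vertex_span g b -> g =1 g' -> b = b' -> vertex_span g' b'.
Proof. by move=> h /funext <- <-. Qed.

Lemma vertex_span_scale k U : gen_vertices U ->
  vertex_span (fun v => k * \1_U v) (k *: q U).
Proof.
move=> gU; apply: vertex_span_ext (vertex_spanD k gU vertex_span0) _ _ => [v|].
  by rewrite addr0.
by rewrite addr0.
Qed.

Lemma vertex_span_gen U : gen_vertices U -> vertex_span \1_U (q U).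
Proof.
move=> gU; apply: vertex_span_ext (vertex_span_scale 1 gU) _ _ => [v|].
  by rewrite mul1r.
by rewrite scale1r.
Qed.

Lemma vertex_span_lin k g b g' b' : vertex_span g b -> vertex_span g' b' ->
  vertex_span (fun v => k * g v + g' v) (k *: b + b').
Proof.
elim=> [|k1 U g1 b1 gU _ IH] h.
  by apply: vertex_span_ext h _ _ => [v|]; rewrite ?mulr0 ?scaler0 add0r.
apply: vertex_span_ext (vertex_spanD (k * k1) gU (IH h)) _ _ => [v|].
  by rewrite mulrDr mulrA addrA.
by rewrite scalerDr scalerA addrA.
Qed.

Lemma vertex_span_mulq U g b : gen_vertices U -> vertex_span g b ->
  vertex_span (fun v => \1_U v * g v) (q U ** b).
Proof.
move=> gU; elim=> [|k W g' b' gW _ IH].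
  by apply: vertex_span_ext vertex_span0 _ _ => [v|]; rewrite ?mulr0 ?cmul0r.
apply: vertex_span_ext (vertex_spanD k (gen_verticesI gU gW) IH) _ _ => [v|].
  by rewrite indicI /= mulrDr; congr (_ + _); rewrite mulrCA.
by rewrite cmulDr -cscalerAr (uf_setI qt).
Qed.

Lemma vertex_span_mul g b g' b' : vertex_span g b -> vertex_span g' b' ->
  vertex_span (fun v => g v * g' v) (b ** b').
Proof.
move=> h h'; elim: h => [|k W g1 b1 gW _ IH].
  by apply: vertex_span_ext vertex_span0 _ _ => [v|]; rewrite ?mul0r ?cmul0l.
apply: vertex_span_ext (vertex_span_lin k (vertex_span_mulq gW h') IH) _ _ => [v|].
  by rewrite mulrDl mulrA.
by rewrite cmulDl cscalerAl.
Qed.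

Lemma vertex_span_comm U g b : gen_vertices U -> vertex_span g b ->
  b ** q U = q U ** b.
Proof.
move=> gU; elim=> [|k W g' b' gW _ IH]; first by rewrite cmul0l cmul0r.
by rewrite cmulDl cmulDr IH -cscalerAl -cscalerAr !(uf_setI qt) // setIC.
Qed.

Lemma vertex_span_support g b : vertex_span g b ->
  exists2 P, gen_vertices P & b ** q P = b.
Proof.
elim=> [|k U g' b' gU _ [P gP bP]].
  by exists set0; [exact: gen_vertices0|rewrite cmul0l].
have gUP := gen_verticesU gU gP.
exists (U `|` P) => //; rewrite cmulDl -cscalerAl; congr (_ + _).
  by rewrite (uf_setI qt) // [U `|` P]setUC setKU.
by rewrite -{1}bP -cmulA (uf_setI qt) // setKU bP.
Qed.

Lemma vertex_span_edge g b e : vertex_span g b ->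
  b ** t e = g (usource e) *: t e.
Proof.
elim=> [|k U g' b' gU _ IH]; first by rewrite cmul0l scale0r.
by rewrite cmulDl IH -cscalerAl q_edge // scalerA -scalerDl.
Qed.

(** This is [vertex_span_vanish] on [P `\` F], for a [P] that supports [b]. *)
Lemma vertex_span_vanish_off g b F : vertex_span g b -> gen_vertices F ->
  (forall v, ~ F v -> g v = 0) -> b - b ** q F = 0.
Proof.
move=> h gF g0; have [P gP bP] := vertex_span_support h.
have := vertex_span_vanish h (k := 0) gP gF.
rewrite scale0r add0r cmulBr bP -(uf_setI qt) // cmulA bP; apply.
by move=> v _ nFv; rewrite add0r g0.
Qed.

(** Finite sets of vertices are negligible, because [q_v] is a finite sum of the
    [t_e t_e^*]; the definition keeps the consequence of finiteness that matters
    for uniqueness. *)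
Definition negligible F : Prop :=
  gen_vertices F /\ forall y, (forall e, y ** t e = 0) -> y ** q F = 0.

Lemma negligible0 : negligible set0.
Proof.
by split=> [|y _]; [exact: gen_vertices0|rewrite (uf_set0 qt) cmul0r].
Qed.

Lemma negligible1 v : negligible [set v].
Proof.
split=> [|y yt]; first exact: gen_vertices1.
by rewrite vertex_sum cmul_sumr big1 // => e _; rewrite cmulA yt cmul0l.
Qed.

Lemma negligibleU F F' : negligible F -> negligible F' -> negligible (F `|` F').
Proof.
move=> [gF h] [gF' h']; split=> [|y yt]; first exact: gen_verticesU.
rewrite (uf_setU qt) // -(uf_setI qt) // cmulBr cmulDr cmulA.
by rewrite h // h' // cmul0l addr0 subr0.
Qed.

(** The function [x |-> f (e x)], extended by [0] to those [x] for which [e x] is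
    not a path, since [t_e^* a t_e] vanishes outside [q_r(e)]. *)
Definition after e f x : R[i] :=
  if `[< urange e (usource (x 0)) >] then f (prepend [:: e] x) else 0.

(** [a] acts as [f] on paths, where [n] bounds the number of edges after which
    only the next vertex matters. The equation [a t_e = t_e t_e^* a t_e] says
    that [a] preserves the range of [t_e], so that [a] is controlled by its
    compressions, and compression is multiplicative. *)
Fixpoint represents (n : nat) f a : Prop :=
  if n is n'.+1 then
    (exists F g b, [/\ negligible F, vertex_span g b,
       forall x, X x -> ~ F (usource (x 0)) -> f x = g (usource (x 0)) &
       a - a ** q F = b - b ** q F])
    /\ (forall e, a ** t e = t e ** ((t e)^* ** a ** t e)
         /\ represents n' (after e f) ((t e)^* ** a ** t e))
  else exists2 g, vertex_span g a & forall x, X x -> f x = g (usource (x 0)).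

Lemma represents_ext n f f' a : (forall x, X x -> f x = f' x) ->
  represents n f a -> represents n f' a.
Proof.
elim: n f f' a => [|n IH] f f' a ff' /=.
  by move=> [g gs fg]; exists g => // x Xx; rewrite -ff' // fg.
move=> [[F [g [b [nF gb fg ab]]]] h]; split.
  by exists F, g, b; split=> // x Xx nFx; rewrite -ff' // fg.
move=> e; have [h1 h2] := h e; split=> //; apply: IH h2 => x Xx.
rewrite /after; case: asboolP => // rx; apply: ff'.
by apply/edge_subshift_prepend1.
Qed.

(** An element that depends on the first vertex alone acts on [t_e] by a scalar;
    the negligible set is then empty. *)
Lemma represents_succ n f a : represents n f a -> represents n.+1 f a.
Proof.
elim: n f a => [|n IH] f a; last first.
  by move=> [h1 h2]; split=> // e; have [h3 h4] := h2 e; split=> //; apply: IH.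
move=> [g ga fg]; split.
  exists set0, g, a; split=> //; first exact: negligible0.
  by move=> x Xx _; exact: fg.
move=> e; rewrite -cmulA !(vertex_span_edge e ga) -!cscalerAr.
rewrite cmulA (uf_pisom qt e); split=> //.
rewrite (uf_range qt).
exists (fun v => g (usource e) * \1_(urange e) v).
  exact: vertex_span_scale (gen_vertices_range e).
move=> x Xx; rewrite /after indicE; case: asboolP => rx.
  rewrite (mem_set rx) mulr1 fg //; exact/edge_subshift_prepend1.
by rewrite (memNset rx) mulr0.
Qed.

Lemma represents_leq m n f a : (m <= n)%N -> represents m f a -> represents n f a.
Proof.
move=> /subnK <-; elim: (n - m)%N => // k IH h.
by rewrite addSn; apply: represents_succ; exact: IH.
Qed.

Lemma off_union a b F F' : gen_vertices F -> gen_vertices F' ->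
  a - a ** q F = b - b ** q F -> a - a ** q (F `|` F') = b - b ** q (F `|` F').
Proof.
move=> gF gF' ab.
have E d : d - d ** q (F `|` F') = (d - d ** q F) - (d - d ** q F) ** q F'.
  rewrite (uf_setU qt) // -(uf_setI qt) // cmulBr cmulDr cmulBl cmulA.
  by rewrite !opprB !addrA addrAC opprD addrA [RHS]addrAC.
by rewrite !E ab.
Qed.

Lemma represents_lin n k f a f' a' : represents n f a -> represents n f' a' ->
  represents n (fun x => k * f x + f' x) (k *: a + a').
Proof.
elim: n f a f' a' => [|n IH] f a f' a'.
  move=> [g ga fg] [g' ga' fg']; exists (fun v => k * g v + g' v).
    exact: vertex_span_lin.
  by move=> x Xx; rewrite fg // fg'.
move=> [[F [g [b [nF gb fg ab]]]] h] [[F' [g' [b' [nF' gb' fg' ab']]]] h'].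
split.
  exists (F `|` F'), (fun v => k * g v + g' v), (k *: b + b'); split.
  - exact: negligibleU.
  - exact: vertex_span_lin.
  - by move=> x Xx /not_orP [nFx nF'x]; rewrite fg // fg'.
  - have [gF _] := nF; have [gF' _] := nF'.
    rewrite !cmulDl -!cscalerAl !opprD addrACA [RHS]addrACA -!scalerBr.
    by rewrite (off_union gF gF' ab) setUC (off_union gF' gF ab').
move=> e; have [h1 h2] := h e; have [h3 h4] := h' e.
have E : (t e)^* ** (k *: a + a') ** t e =
    k *: ((t e)^* ** a ** t e) + (t e)^* ** a' ** t e.
  by rewrite cmulDr cmulDl -cscalerAr -cscalerAl.
rewrite E; split.
  by rewrite cmulDr cmulDl -cscalerAr -cscalerAl -h1 -h3.
apply: represents_ext (IH _ _ _ _ h2 h4) => x _; rewrite /after.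
by case: asboolP; rewrite ?mulr0 ?addr0.
Qed.

Lemma represents_mul n f a f' a' : represents n f a -> represents n f' a' ->
  represents n (fun x => f x * f' x) (a ** a').
Proof.
elim: n f a f' a' => [|n IH] f a f' a'.
  move=> [g ga fg] [g' ga' fg']; exists (fun v => g v * g' v).
    exact: vertex_span_mul.
  by move=> x Xx; rewrite fg // fg'.
move=> [[F [g [b [nF gb fg ab]]]] h] [[F' [g' [b' [nF' gb' fg' ab']]]] h'].
split.
  exists (F `|` F'), (fun v => g v * g' v), (b ** b'); split.
  - exact: negligibleU.
  - exact: vertex_span_mul.
  - by move=> x Xx /not_orP [nFx nF'x]; rewrite fg // fg'.
  - have [gF _] := nF; have [gF' _] := nF'.
    have {}ab := off_union gF gF' ab.
    have {}ab' : a' - a' ** q (F `|` F') = b' - b' ** q (F `|` F').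
      by rewrite setUC; exact: off_union ab'.
    have gFF := gen_verticesU gF gF'.
    rewrite -!cmulA -!cmulBr ab' (vertex_span_comm gFF gb').
    by rewrite !cmulBr !cmulA -!cmulBl ab.
move=> e; have [h1 h2] := h e; have [h3 h4] := h' e.
have E : (t e)^* ** (a ** a') ** t e =
    ((t e)^* ** a ** t e) ** ((t e)^* ** a' ** t e).
  by rewrite -[RHS]cmulA -h3 !cmulA.
rewrite E; split.
  by rewrite -cmulA h3 cmulA h1 !cmulA.
apply: represents_ext (IH _ _ _ _ h2 h4) => x _; rewrite /after.
by case: asboolP; rewrite ?mulr0.
Qed.

(** Each compression is zero by induction, so [a] kills all the [t_e], hence also
    [q F]. Off [F] the element is a combination of the [q_U] whose function
    vanishes, because every vertex starts a path. *)
Lemma represents_eq0 n f a : represents n f a ->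
  (forall x, X x -> f x = 0) -> a = 0.
Proof.
elim: n f a => [|n IH] f a.
  move=> [g ga fg] f0.
  have := vertex_span_vanish_off ga (@gen_vertices0 G).
  rewrite (uf_set0 qt) cmul0r subr0; apply => v _.
  by have [x Xx <-] := exists_path_vertex Greg v; rewrite -fg ?f0.
move=> [[F [g [b [[gF nF] gb fg ab]]]] h] f0.
have aF : a ** q F = 0.
  apply: nF => e; have [-> h2] := h e.
  rewrite (IH _ _ h2) ?cmul0r // => x Xx; rewrite /after.
  by case: asboolP => // rx; apply: f0; apply/edge_subshift_prepend1.
move: ab; rewrite aF subr0 => ->; apply: vertex_span_vanish_off gb gF _ => v nFv.
have [x Xx xv] := exists_path_vertex Greg v.
by rewrite -xv -fg ?f0 // xv.
Qed.

Lemma represents_gen n U : gen_vertices U ->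
  represents n (fun x => \1_U (usource (x 0))) (q U).
Proof.
move=> gU; apply: (@represents_leq 0) => //.
by exists \1_U => //; exact: vertex_span_gen.
Qed.

Lemma represents0 n : represents n (fun=> 0) 0.
Proof.
by apply: (@represents_leq 0) => //; exists (fun=> 0) => //; exact: vertex_span0.
Qed.

(** Conjugation by [t_e] moves a function to the cylinder of [e]: it is supported
    over the single vertex [s(e)], and its compression by another edge is
    zero. *)
Lemma represents_edge n e f a : represents n f a ->
  represents n.+1 (fun x => if x 0 == e then f (fun i => x i.+1) else 0)
    (t e ** a ** (t e)^*).
Proof.
move=> h; have ts : (t e)^* ** q [set usource e] = (t e)^*.
  have [qs _] := uf_proj qt (@gen_vertices1 G (usource e)).
  by rewrite -[RHS](congr1 cstar (vertex_edge e)) cstarM qs.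
split.
  exists [set usource e], (fun=> 0), 0; split.
  - exact: negligible1.
  - exact: vertex_span0.
  - by move=> x _; case: eqP => [->|//]; case.
  - by rewrite cmul0l subr0 -[X in _ - X]cmulA ts subrr.
move=> e'; have [<-|ee'] := pselect (e = e'); last first.
  have z : t e ** a ** (t e)^* ** t e' = 0 by rewrite -cmulA edge_orth ?cmul0r.
  have z' : (t e')^* ** (t e ** a ** (t e)^*) ** t e' = 0.
    by rewrite -cmulA z cmul0r.
  rewrite z' z cmul0r; split=> //.
  apply: represents_ext (represents0 n) => x Xx; rewrite /after /=.
  by case: asboolP => // _; case: eqP => // e'e; case: ee'.
have E : (t e)^* ** (t e ** a ** (t e)^*) ** t e
    = q (urange e) ** a ** q (urange e) by rewrite -(uf_range qt) !cmulA.
rewrite E; split.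
  by rewrite !cmulA edge_range -(uf_range qt) !cmulA.
have hr := represents_gen n (gen_vertices_range e).
apply: represents_ext (represents_mul (represents_mul hr h) hr) => x Xx.
rewrite /after indicE eqxx; case: asboolP => rx; last first.
  by rewrite (memNset rx) !mul0r.
rewrite (mem_set rx) mulr1 mul1r; congr f; apply/funext => i.
by rewrite prepend1S.
Qed.

(** [word_elt] folds from the left, so that only the last letter of a word comes
    off by computation. *)
Lemma word_elt_cons e w : w <> [::] -> word_elt t (e :: w) = t e ** word_elt t w.
Proof.
case: w => // f w _ /=; elim: w (t f) => //= f' w IH c.
by rewrite -cmulA IH.
Qed.

Lemma word_elt_rcons e w : w <> [::] ->
  word_elt t (rcons w e) = word_elt t w ** t e.
Proof. by case: w => // f w _; rewrite /= foldl_rcons. Qed.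

Lemma word_elt_range e w :
  word_elt t (rcons w e) ** q (urange e) = word_elt t (rcons w e).
Proof.
case: w => [|f w]; first exact: edge_range.
by rewrite word_elt_rcons // -cmulA edge_range.
Qed.

Lemma represents_after n e f a : represents n f a ->
  represents n (after e f) ((t e)^* ** a ** t e).
Proof. by move=> /represents_succ [_ h]; have [] := h e. Qed.

Lemma Cset_source (w : seq (edge G)) :
  Cset X w [::] = [set x | X x /\ X (prepend w x)].
Proof.
apply/seteqP; split=> [_ [x [Xx wx] <-]|x [Xx wx]].
  by move: Xx; rewrite prepend0.
by exists x; rewrite ?prepend0 /= ?prepend0.
Qed.

(** [C(w,omega)] is obtained from [r] of the first letter of [w] by prescribing
    the following letters one at a time, each time compressing by the letter. *)
Lemma represents_source (w : seq (edge G)) : w <> [::] ->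
  exists n, represents n \1_(Cset X w [::]) ((word_elt t w)^* ** word_elt t w).
Proof.
elim/last_ind: w => // w e IH _; have [->|/eqP w0] := eqVneq w [::].
  exists 0; rewrite /= (uf_range qt).
  apply: represents_ext (represents_gen 0 (gen_vertices_range e)) => x Xx.
  rewrite Cset_source !indicE; congr (_ (_ : bool))%:R.
  apply/idP/idP => /set_mem h; apply/mem_set => /=.
    by split=> //; apply/edge_subshift_prepend1.
  by case: h => _ /edge_subshift_prepend1 [].
have [n h] := IH w0; exists n; rewrite word_elt_rcons //.
have -> : (word_elt t w ** t e)^* ** (word_elt t w ** t e)
    = (t e)^* ** ((word_elt t w)^* ** word_elt t w) ** t e.
  by rewrite cstarM !cmulA.
apply: represents_ext (represents_after e h) => x Xx.
rewrite /after !Cset_source !indicE; case: asboolP => rx.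
  congr (_ (_ : bool))%:R; apply/idP/idP => /set_mem h'; apply/mem_set => /=.
    by rewrite prepend_rcons; case: h'.
  move: h'; rewrite /= prepend_rcons => -[_ ?]; split=> //.
  exact/edge_subshift_prepend1.
rewrite memNset //= prepend_rcons => -[_ /edge_subshift_suffix].
by move/edge_subshift_prepend1 => [].
Qed.

Lemma represents_prepend (w : seq (edge G)) n (S : set (nat -> edge G)) a :
    w <> [::] -> represents n \1_S a ->
  exists m, represents m \1_(prepend w @` S)
                         (word_elt t w ** a ** (word_elt t w)^*).
Proof.
have step e m (T : set (nat -> edge G)) b : represents m \1_T b ->
    represents m.+1 \1_(prepend [:: e] @` T) (t e ** b ** (t e)^*).
  move=> /(represents_edge e); apply: represents_ext => x _; case: eqP => [xe|xe].
    rewrite !indicE; congr (_ (_ : bool))%:R.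
    apply/idP/idP => /set_mem; last first.
      move=> [y Ty yx]; apply/mem_set.
      rewrite (_ : (fun i => x i.+1) = y) //.
      by apply/funext => i; rewrite -yx prepend1S.
    move=> Tx; apply/mem_set; exists (fun i => x i.+1) => //.
    by rewrite -xe prepend_tail.
  by rewrite indicE memNset // => -[y _ yx]; apply: xe; rewrite -yx.
elim: w => // e w IH _ h; have [->|/eqP w0] := eqVneq w [::].
  by exists n.+1; exact: step.
have [m h'] := IH w0 h; exists m.+1.
rewrite word_elt_cons // cstarM.
have -> : prepend (e :: w) @` S = prepend [:: e] @` (prepend w @` S).
  by rewrite image_comp; apply: eq_imagel => x _ /=; rewrite prepend_cons.
by rewrite !cmulA -[t e ** _ ** _]cmulA -[X in X ** _]cmulA; exact: step.
Qed.

(** Conjugate the element of [C(a,omega)] by the word [b]. On infinite paths this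
    is [C(a,b)], as the tail of a path is a path. *)
Lemma represents_Cset (a b : seq (edge G)) : a <> [::] -> b <> [::] ->
  exists n, represents n \1_(Cset X a b)
    (word_elt t b ** (word_elt t a)^* ** word_elt t a ** (word_elt t b)^*).
Proof.
move=> a0 b0; have [n h] := represents_source a0.
have [m h'] := represents_prepend b0 h; exists m.
rewrite -[word_elt t b ** _ ** _]cmulA; apply: represents_ext h' => x Xx.
rewrite !indicE; congr (_ (_ : bool))%:R.
apply/idP/idP => /set_mem; rewrite Cset_source => -[y yP yx]; apply/mem_set.
  by exists y => //; case: yP => _ ay; split=> //; rewrite yx.
by exists y => //; case: yP => /edge_subshift_suffix.
Qed.

(** [t_b t_b^*] is the conjugate by [t_b] of [q_r(e)], where [e] is the last letter
    of [b]. *)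
Lemma represents_range (b : seq (edge G)) : b <> [::] ->
  exists n, represents n \1_(Cset X [::] b) (word_elt t b ** (word_elt t b)^*).
Proof.
case/lastP: b => // w e b0.
have h : represents 0 \1_[set x : nat -> edge G | urange e (usource (x 0))]
    (q (urange e)).
  apply: represents_ext (represents_gen 0 (gen_vertices_range e)) => x _.
  by rewrite !indicE.
have [m h'] := represents_prepend b0 h; exists m.
rewrite word_elt_range in h'; apply: represents_ext h' => x Xx.
rewrite !indicE; congr (_ (_ : bool))%:R.
apply/idP/idP => /set_mem [y yP yx]; apply/mem_set; exists y => //.
  rewrite /= prepend0 yx; split=> //.
  by move: Xx; rewrite -yx => /edge_subshift_suffix.
case: yP => /=; rewrite prepend_rcons => /edge_subshift_suffix.
by move=> /edge_subshift_prepend1 [].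
Qed.

Definition realizes (W : set (nat -> edge G)) a : Prop :=
  a^* = a /\ exists n, represents n \1_W a.

Lemma represents_unique n n' f a f' a' :
  represents n f a -> represents n' f' a' ->
  (forall x, X x -> f x = f' x) -> a = a'.
Proof.
move=> h h' ff'.
have {}h := represents_leq (leq_maxl n n') h.
have {}h' := represents_leq (leq_maxr n n') h'.
have /represents_eq0 E := represents_lin (-1) h h'.
apply/esym/eqP; rewrite -subr_eq0 addrC -scaleN1r E //.
by move=> x Xx; rewrite ff' // mulN1r addNr.
Qed.

Lemma realizes_unique W a b : realizes W a -> realizes W b -> a = b.
Proof. by move=> [_ [n h]] [_ [m h']]; apply: represents_unique h h' _. Qed.

(** The two products represent the same function, so the factors commute; this
    makes their product self-adjoint. *)
Lemma realizesI V W a b : realizes V a -> realizes W b ->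
  realizes (V `&` W) (a ** b).
Proof.
move=> [sa [n h]] [sb [m h']].
have {}h := represents_leq (leq_maxl n m) h.
have {}h' := represents_leq (leq_maxr n m) h'.
have hab := represents_mul h h'.
split; last by exists (maxn n m); apply: represents_ext hab => x _; rewrite indicI.
rewrite cstarM sa sb.
by apply: represents_unique (represents_mul h' h) hab _ => x _; rewrite mulrC.
Qed.

Lemma realizes_idem W a : realizes W a -> a ** a = a.
Proof.
move=> h; apply: (@realizes_unique W) => //.
by rewrite -{1}[W]setIid; exact: realizesI.
Qed.

Lemma realizesD V W a b : realizes V a -> realizes W b ->
  realizes (V `\` W) (a - a ** b).
Proof.
move=> ha hb; have [sab [m h']] := realizesI ha hb; have [sa [n h]] := ha.
split; first by rewrite cstarB sa sab.
have {}h := represents_leq (leq_maxl n m) h.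
have {}h' := represents_leq (leq_maxr n m) h'.
exists (maxn n m); rewrite addrC -scaleN1r.
apply: represents_ext (represents_lin (-1) h' h) => x _.
rewrite !indicE in_setD in_setI.
by case: (x \in V); case: (x \in W); rewrite /= ?mulr1 ?mulr0 ?addNr ?add0r.
Qed.

Lemma realizesU V W a b : realizes V a -> realizes W b ->
  realizes (V `|` W) (a + b - a ** b).
Proof.
move=> ha hb; have [s1 [n h]] := realizesD ha hb; have [sb [m h']] := hb.
rewrite addrAC; split; first by rewrite cstarD s1 sb.
have {}h := represents_leq (leq_maxl n m) h.
have {}h' := represents_leq (leq_maxr n m) h'.
exists (maxn n m); rewrite -[X in represents _ _ (X + _)]scale1r.
apply: represents_ext (represents_lin 1 h h') => x _.
rewrite !indicE in_setD in_setU.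
by case: (x \in V); case: (x \in W); rewrite /= ?mulr1 ?mulr0 ?addr0 ?add0r.
Qed.

Lemma realizes0 : realizes set0 0.
Proof.
split; first exact: cstar0.
by exists 0; apply: represents_ext (represents0 0) => x _; rewrite indic0.
Qed.

Lemma realizes_boolalg W : shift_boolalg X W -> exists a, realizes W a.
Proof.
move=> hW; apply: (hW [set W | exists a, realizes W a]); split.
  split.
  - by exists 0; exact: realizes0.
  - by move=> U V [a ha] [b hb]; exists (a + b - a ** b); exact: realizesU.
  - by move=> U V [a ha] [b hb]; exists (a - a ** b); exact: realizesD.
move=> _ [a [b [_ _ ab ->]]].
have [a0|/eqP a0] := eqVneq a [::]; have [b0|/eqP b0] := eqVneq b [::].
- by case: ab.
- rewrite a0; have h := represents_range b0.
  exists (word_elt t b ** (word_elt t b)^*).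
  by split=> //; rewrite cstarM cstarK.
- rewrite b0; have h := represents_source a0.
  exists ((word_elt t a)^* ** word_elt t a).
  by split=> //; rewrite cstarM cstarK.
have h := represents_Cset a0 b0; eexists; split; last exact: h.
by rewrite !cstarM !cstarK !cmulA.
Qed.

Definition path_proj (W : set (nat -> edge G)) : A := xget 0 (realizes W).

Lemma path_projE W a : realizes W a -> path_proj W = a.
Proof. by move=> h; apply: (realizes_unique _ (h)); exact: xgetI h. Qed.

Lemma path_projP W : shift_boolalg X W -> realizes W (path_proj W).
Proof. by move=> /realizes_boolalg; exact: xgetPex. Qed.

Lemma ultragraph_to_subshift_family : subshift_family X path_proj t.
Proof.
split.
- move=> U /path_projP h; split; first exact: h.1.
  exact: realizes_idem h.
- exact: uf_pisom qt.
- by move=> U W /path_projP hU /path_projP hW; apply: path_projE; exact: realizesI.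
- move=> U W /path_projP hU /path_projP hW.
  by rewrite (path_projE (realizesI hU hW)); apply: path_projE; exact: realizesU.
- exact: path_projE realizes0.
- move=> a b _ _ a0 b0; apply/esym/path_projE; split; last exact: represents_Cset.
  by rewrite !cstarM !cstarK !cmulA.
- move=> a _ a0; apply/esym/path_projE; split; last exact: represents_source.
  by rewrite cstarM cstarK.
- move=> b _ b0; apply/esym/path_projE; split; last exact: represents_range.
  by rewrite cstarM cstarK.
Qed.

(** A family with regular vertices is generated by its edge elements. *)
Lemma edge_fixing_hom (chi : A -> A) : star_hom chi -> (forall e, chi (t e) = t e) ->
  forall U, gen_vertices U -> chi (q U) = q U.
Proof.
move=> hchi ct; have [_ cM cS] := hchi.
apply: gen_vertices_ind => [|v|e|U W gU gW cU cW|U W gU gW cU cW].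
- by rewrite (uf_set0 qt) (star_hom0 hchi).
- rewrite vertex_sum (big_morph chi (star_homD hchi) (star_hom0 hchi)).
  by apply: eq_bigr => e _; rewrite cM cS ct.
- by rewrite -(uf_range qt) cM cS ct.
- rewrite (uf_setU qt) // -(uf_setI qt) //.
  by rewrite (star_homB hchi) (star_homD hchi) cM cU cW.
- by rewrite -(uf_setI qt) // cM cU cW.
Qed.

End UltragraphFamily.

(** * From a subshift family to an ultragraph family *)

Section SubshiftFamily.
Variables (R : realType) (G : ultragraph).
Hypothesis Greg : forall v : vertex G, regular_vertex v.
Variables (B : cstarAlgType R) (p : set (nat -> edge G) -> B) (s : edge G -> B).
Local Notation X := (edge_subshift G).
Hypothesis ps : subshift_family X p s.
Implicit Types (e : edge G) (v : vertex G) (U W : set (vertex G))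
  (S T : set (nat -> edge G)) (x : nat -> edge G).

Lemma boolalg_setring : setring (shift_boolalg X).
Proof. exact: smallest_setring. Qed.

Lemma boolalg0 : shift_boolalg X set0.
Proof. by have [] := boolalg_setring. Qed.

Lemma boolalgU : setU_closed (shift_boolalg X).
Proof. by have [] := boolalg_setring. Qed.

Lemma boolalgD : setD_closed (shift_boolalg X).
Proof. by have [] := boolalg_setring. Qed.

Lemma boolalgI : setI_closed (shift_boolalg X).
Proof. by move=> S T hS hT; rewrite -setDD; do 2!apply: boolalgD => //. Qed.

Lemma boolalg_Cset a b : language X a -> language X b ->
  ~ (a = [::] /\ b = [::]) -> shift_boolalg X (Cset X a b).
Proof. by move=> la lb ab; apply: sub_gen_smallest; exists a, b. Qed.

(** [S] is the disjoint union of [S `\` T] and [S `&` T]. *)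
Lemma family_setD S T : shift_boolalg X S -> shift_boolalg X T ->
  p (S `\` T) = p S - p S ** p T.
Proof.
move=> hS hT; have hD := boolalgD hS hT; have hI := boolalgI hS hT.
apply/eqP; rewrite eq_sym subr_eq -(sf_setI ps) //; apply/eqP.
have := sf_setU ps hD hI.
rewrite (_ : (S `\` T) `&` (S `&` T) = set0) ?(sf_set0 ps) ?subr0; last first.
  by apply/seteqP; split=> // x [[_ nT] [_ /nT]].
by rewrite setUC setUIDK.
Qed.

Definition starting_in U : set (nat -> edge G) := [set x | X x /\ U (usource (x 0))].

Lemma starting_inI U W : starting_in (U `&` W) = starting_in U `&` starting_in W.
Proof. by apply/seteqP; split=> x; [move=> [? []]|move=> [[? ?] []]]. Qed.

Lemma starting_inU U W : starting_in (U `|` W) = starting_in U `|` starting_in W.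
Proof.
apply/seteqP; split=> x; first by move=> [? [?|?]]; [left|right].
by move=> [[? ?]|[? ?]]; split=> //; [left|right].
Qed.

Lemma starting_in0 : starting_in set0 = set0.
Proof. by apply/seteqP; split=> x // []. Qed.

Lemma starting_in_range e : starting_in (urange e) = Cset X [:: e] [::].
Proof.
rewrite Cset_source; apply/seteqP; split=> x.
  by move=> [Xx ex]; split=> //; apply/edge_subshift_prepend1.
by move=> [Xx /edge_subshift_prepend1[]].
Qed.

Lemma Cset_edge e : Cset X [::] [:: e] = [set x | X x /\ x 0 = e].
Proof.
apply/seteqP; split=> x; first by move=> [y [Xy _] <-].
move=> [Xx <-]; exists (fun n => x n.+1); last exact: prepend_tail.
by rewrite /= prepend0 prepend_tail; split=> //; exact: edge_subshift_tail Xx.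
Qed.

Lemma boolalg_edge e : shift_boolalg X (Cset X [::] [:: e]).
Proof.
apply: boolalg_Cset => [||[]//]; first by left.
exact: language_edge.
Qed.

(** Membership and value are proved together, since additivity of [p] is available
    on the Boolean algebra only. *)
Lemma boolalg_edges (l : seq (edge G)) : uniq l ->
  shift_boolalg X [set x | X x /\ x 0 \in l] /\
  p [set x | X x /\ x 0 \in l] = \sum_(e <- l) (s e ** (s e)^*).
Proof.
elim: l => [_|e l IH /andP[el ul]].
  rewrite big_nil (_ : [set x | _] = set0); last by apply/seteqP; split=> x // [].
  by split; [exact: boolalg0|exact: sf_set0 ps].
have [hl pl] := IH ul.
have E : [set x | X x /\ x 0 \in e :: l]
    = Cset X [::] [:: e] `|` [set x | X x /\ x 0 \in l].
  rewrite Cset_edge; apply/seteqP; split=> x /=.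
    by rewrite inE => -[Xx /orP[/eqP|]]; [left|right].
  by rewrite inE => -[[Xx /eqP ->]|[Xx ->]]; rewrite ?orbT.
have he := boolalg_edge e.
rewrite E; split; first exact: boolalgU.
rewrite (sf_setU ps) // (_ : _ `&` _ = set0) ?(sf_set0 ps) ?subr0; last first.
  rewrite Cset_edge; apply/seteqP; split=> // x.
  by case=> -[_ xe] [_]; rewrite xe (negbTE el).
rewrite big_cons pl; congr (_ + _).
by rewrite -(sf_Cr ps) //; exact: language_edge.
Qed.

Lemma starting_in_vertex v :
  starting_in [set v] = [set x | X x /\ x 0 \in (fset_set (edges_from v) : seq _)].
Proof.
by apply/seteqP; split=> x /=; rewrite mem_edges_from // => -[Xx /asboolP xv].
Qed.

Lemma boolalg_starting U : gen_vertices U -> shift_boolalg X (starting_in U).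
Proof.
move: U; apply: gen_vertices_ind => [|v|e|U W _ _ hU hW|U W _ _ hU hW].
- by rewrite starting_in0; exact: boolalg0.
- by rewrite starting_in_vertex; apply: (boolalg_edges _).1; exact: finmap.fset_uniq.
- rewrite starting_in_range; apply: boolalg_Cset => [||[]//]; last by left.
  exact: language_edge.
- by rewrite starting_inU; exact: boolalgU.
- by rewrite starting_inI; exact: boolalgI.
Qed.

Lemma subshift_to_ultragraph_family :
  ultragraph_family (fun U => p (starting_in U)) s.
Proof.
have hb := boolalg_starting.
split.
- by move=> U /hb h; exact: (sf_proj ps h).
- exact: sf_pisom ps.
- move=> e f ef; rewrite !(sf_Cr ps (b := [:: _])) //; try exact: language_edge.
  have [he hf] := (boolalg_edge e, boolalg_edge f).
  rewrite -(sf_setI ps) // (_ : _ `&` _ = set0) ?(sf_set0 ps) //.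
  rewrite !Cset_edge; apply/seteqP; split=> // x [[_ xe] [_ xf]].
  by apply: ef; rewrite -xe.
- by rewrite starting_in0 (sf_set0 ps).
- by move=> U W /hb hU /hb hW; rewrite starting_inI (sf_setI ps).
- by move=> U W /hb hU /hb hW; rewrite starting_inU starting_inI (sf_setU ps).
- move=> e; rewrite starting_in_range -(sf_Cl ps) //; exact: language_edge.
- move=> e; have hv := hb _ (gen_vertices1 (usource e)); have he := boolalg_edge e.
  (* [q_s(e) - s_e s_e^*] is itself a projection, that of the paths that start at
     [s(e)] with another edge. *)
  have [ss si] := sf_proj ps (boolalgD hv he).
  exists (p (starting_in [set usource e] `\` Cset X [::] [:: e])).
  rewrite ss si family_setD //.
  have -> : s e ** (s e)^* = p (Cset X [::] [:: e]).
    by rewrite -(sf_Cr ps) //; exact: language_edge.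
  rewrite -(sf_setI ps) // setIidr // => x.
  by rewrite Cset_edge => -[Xx <-].
- move=> v _; rewrite fsbig_finite /=; last exact: (Greg v).2.
  by rewrite starting_in_vertex; apply: (boolalg_edges _).2; exact: finmap.fset_uniq.
Qed.

Lemma word_elt_hom (chi : B -> B) : star_hom chi -> (forall e, chi (s e) = s e) ->
  forall w, chi (word_elt s w) = word_elt s w.
Proof.
move=> hchi cs [|e w]; first exact: star_hom0.
have [_ cM _] := hchi.
rewrite /= -{2}(cs e); elim: w (s e) => //= f w IH c.
by rewrite IH cM cs.
Qed.

(** The sets on which [chi] is the identity form a ring that contains the
    [C(a,b)], whose elements are products of letters and their adjoints. *)
Lemma letter_fixing_hom (chi : B -> B) :
  star_hom chi -> (forall e, chi (s e) = s e) ->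
  forall S, shift_boolalg X S -> chi (p S) = p S.
Proof.
move=> hchi cs S hS; have [_ cM cS] := hchi; have cw := word_elt_hom hchi cs.
suff [] : (shift_boolalg X `&` [set T | chi (p T) = p T]) S by [].
apply: hS; split.
  split.
  - split; [exact: boolalg0|by rewrite /= (sf_set0 ps) star_hom0].
  - move=> T T' [hT cT] [hT' cT']; split; first exact: boolalgU.
    rewrite /= (sf_setU ps) // (sf_setI ps) //.
    by rewrite (star_homB hchi) (star_homD hchi) cM cT cT'.
  - move=> T T' [hT cT] [hT' cT']; split; first exact: boolalgD.
    by rewrite /= family_setD // (star_homB hchi) cM cT cT'.
move=> _ [a [b [la lb ab ->]]]; split; first exact: boolalg_Cset.
have [a0|/eqP a0] := eqVneq a [::]; have [b0|/eqP b0] := eqVneq b [::].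
- by case: ab.
- by rewrite a0 /= -(sf_Cr ps) // cM cS cw.
- by rewrite b0 /= -(sf_Cl ps) // cM cS cw.
- by rewrite /= -(sf_C ps) // !cM !cS !cw.
Qed.

End SubshiftFamily.

(** * The isomorphism *)

Theorem proposition4p3 (R : realType) (G : ultragraph)
    (Greg : forall v : vertex G, regular_vertex v)
    (A : cstarAlgType R) (q : set (vertex G) -> A) (t : edge G -> A)
    (CG : is_ultragraph_algebra q t)
    (B : cstarAlgType R) (p : set (nat -> edge G) -> B) (s : edge G -> B)
    (OX : is_subshift_algebra (edge_subshift G) p s) :
  star_isomorphic A B.
Proof.
have [qt univA] := CG; have [ps univB] := OX.
have [phi [[hphi _ phit] _]] := univA _ _ _ (subshift_to_ultragraph_family Greg ps).
have [psi [[hpsi _ psis] _]] := univB _ _ _ (ultragraph_to_subshift_family Greg qt).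
exists phi; split=> //; exists psi => a.
- have [chi [_ uniqA]] := univA _ _ _ qt.
  have hc := star_hom_comp hphi hpsi.
  have ct e : (psi \o phi) (t e) = t e by rewrite /= phit psis.
  rewrite -[LHS]/((psi \o phi) a) -(uniqA (psi \o phi)) ?(uniqA id) //.
  by split=> // U; exact: edge_fixing_hom ct U.
- have [chi [_ uniqB]] := univB _ _ _ ps.
  have hc := star_hom_comp hpsi hphi.
  have cs e : (phi \o psi) (s e) = s e by rewrite /= psis phit.
  rewrite -[LHS]/((phi \o psi) a) -(uniqB (phi \o psi)) ?(uniqB id) //.
  by split=> // S; exact: letter_fixing_hom cs S.
Qed.
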